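(* Let $X$ be a real Banach space and let $(e_n,e_n^* )_{n\in\mathbb N}$ in $X\times X^*$ be a Schauder basis of $X$. Assume that for some $e\in X^{**}$ the partial sums $\sum_{i=1}^ne_i$ converge weak$^*$ in $X^{**}$ to $e$ as $n\to\infty$. Let $A:X\rightrightarrows X^*$ be defined by $$\operatorname{gra}A:=\Big\{\Big(\sum_n\big(-\sum_{i>n}\langle e_i,y^*\rangle+\sum_{i<n}\langle e_i,y^*\rangle\big)e_n,\ y^*\Big)\in X\times X^*\ \Big|\ y^*\in\{e\}_\bot\Big\}.$$ Assume that $\liminf_n\|e_n\|>0$. Then the following hold. (i) $A$ is a maximally monotone and linear skew operator. (ii) $A$ is not of type (BR). (iii) $A$ is not of type (D). (iv) $A$ is not unique. (v) Every Banach space containing an (isomorphic) copy of $X$ is not of type (D).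
   Context: All Banach spaces are real; $X$ is identified with its canonical image in $X^{**}$, and $\langle\cdot,\cdot\rangle$ denotes duality pairings (arguments in either order). $\mathbb N=\{1,2,\dots\}$. $(e_n,e_n^* )_{n\in\mathbb N}$ in $X\times X^*$ is a Schauder basis of $X$ if for every $x\in X$ there is a unique real sequence $(\alpha_n)$ with $x=\sum_{n\ge1}\alpha_ne_n$ (norm convergence), where $\alpha_n=\langle x,e_n^*\rangle$ and $\langle e_i,e_j^*\rangle=\delta_{i,j}$. $\{e\}_\bot=\{y^*\in X^*\mid\langle e,y^*\rangle=0\}$. The graph of $A$ consists of those pairs for which $y^*\in\{e\}_\bot$ and the displayed series over $n$ converges in $X$. A set-valued operator $B:X\rightrightarrows X^*$ has graph $\operatorname{gra}B=\{(x,x^* )\mid x^*\in Bx\}$. It is monotone if $\langle x-y,x^*-y^*\rangle\ge0$ for all $(x,x^* ),(y,y^* )\in\operatorname{gra}B$, maximally monotone if moreover it has no proper monotone extension (graph inclusion), linear (a linear relation) if $\operatorname{gra}B$ is a linear subspace, and skew if $\langle x,x^*\rangle=0$ for all $(x,x^* )\in\operatorname{gra}B$. A maximally monotone $B:X\rightrightarrows X^*$ is: - of type (D) if for every $(x^{**},x^* )\in X^{**}\times X^*$ with $\inf_{(a,a^* )\in\operatorname{gra}B}\langle a-x^{**},a^*-x^*\rangle\ge0$ there is a bounded net in $\operatorname{gra}B$ converging weak$^*\times$strong to $(x^{**},x^* )$; - of type (BR) if whenever $(x,x^* )\in X\times X^*$, $\alpha,\beta>0$ and $\inf_{(a,a^*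 )\in\operatorname{gra}B}\langle x-a,x^*-a^*\rangle>-\alpha\beta$, there exists $(b,b^* )\in\operatorname{gra}B$ with $\|x-b\|<\alpha$ and $\|x^*-b^*\|<\beta$; - unique if all maximally monotone extensions of $B$ (graph inclusion) in $X^{**}\times X^*$ coincide. A Banach space is of type (D) if every maximally monotone operator on it is of type (D). *)

(* Defs.v *)
From HB Require Import structures.
From mathcomp Require Import all_boot all_order all_algebra.
From mathcomp Require Import all_classical all_reals all_analysis.

Set Implicit Arguments.
Unset Strict Implicit.
Unset Printing Implicit Defensive.

Import Order.TTheory GRing.Theory Num.Theory.
Import numFieldNormedType.Exports.

Local Open Scope classical_set_scope.
Local Open Scope ring_scope.

(** * The topological dual of a normed space *)

Section Dual.
Context {R : realType} (V : normedModType R).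

Definition continuous_linear_form : {pred V -> R^o} :=
  fun f => `[< linear f /\ continuous f >].

Record dual : Type := Dual {
  dual_val :> V -> R^o ;
  dual_valP : dual_val \in continuous_linear_form }.

HB.instance Definition _ := [isSub for dual_val].
HB.instance Definition _ := [Choice of dual by <:].

Lemma continuous_linear_form_submod : submod_closed continuous_linear_form.
Proof.
split=> [|a f g /asboolP[lf cf] /asboolP[lg cg]]; apply/asboolP; split.
- by move=> b x y /=; rewrite scaler0 addr0.
- by move=> x; exact: cst_continuous.
- move=> b x y; rewrite [LHS]/= !fctE lf lg !scalerDr !scalerA mulrC -!addrA.
  by congr (_ + _); rewrite addrCA.
- by move=> x; apply: cvgD; [apply: cvgZr; exact: cf|exact: cg].
Qed.

HB.instance Definition _ :=
  GRing.isSubmodClosed.Build R (V -> R^o) continuous_linear_form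
    continuous_linear_form_submod.
HB.instance Definition _ := [SubChoice_isSubLmodule of dual by <:].

Lemma dual_linear (f : dual) : linear f.
Proof. by have /asboolP[] := dual_valP f. Qed.

HB.instance Definition _ (f : dual) :=
  GRing.isLinear.Build R V R^o *:%R f (dual_linear f).

Lemma dual_continuous (f : dual) : continuous f.
Proof. by have /asboolP[] := dual_valP f. Qed.

Lemma dual_eqP (f g : dual) : f =1 g -> f = g.
Proof. by move=> fg; apply: val_inj; exact/funext. Qed.

Definition dual_norm (f : dual) : R :=
  sup [set `|f x| | x in [set x : V | `|x| <= 1]].

Lemma dual_norm_has_sup (f : dual) :
  has_sup [set `|f x| | x in [set x : V | `|x| <= 1]].
Proof.
split; first by exists `|f 0|, 0 => //=; rewrite normr0.
have /linear_boundedP/pinfty_ex_gt0[r r0 fr] :=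
  continuous_linear_bounded 0 (@dual_continuous f 0).
exists r => _ [x /= x1 <-]; apply: (le_trans (fr x)).
by rewrite ler_piMr// ltW.
Qed.

Lemma dual_norm_ge0 (f : dual) : 0 <= dual_norm f.
Proof.
apply: le_trans (normr_ge0 (f 0)) _.
by apply: sup_upper_bound; [exact: dual_norm_has_sup|exists 0; rewrite //= normr0].
Qed.

Lemma ler_dual_norm (f : dual) (x : V) : `|f x| <= dual_norm f * `|x|.
Proof.
have [->|x0] := eqVneq x 0; first by rewrite linear0 !normr0 mulr0.
have nx0 : 0 < `|x| by rewrite normr_gt0.
rewrite -ler_pdivrMr//.
apply: sup_upper_bound; first exact: dual_norm_has_sup.
exists (`|x|^-1 *: x) => /=; rewrite ?linearZ/= normrZ normfV normr_id.
  by rewrite mulVf// gt_eqF.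
by rewrite mulrC.
Qed.

Lemma dual_norm_le (f : dual) (M : R) :
  0 <= M -> (forall x, `|f x| <= M * `|x|) -> dual_norm f <= M.
Proof.
move=> M0 fM; apply: ge_sup; first by case: (dual_norm_has_sup f).
by move=> _ [x /= x1 <-]; apply: (le_trans (fM x)); rewrite ler_piMr.
Qed.

Lemma dual_normD (f g : dual) : dual_norm (f + g) <= dual_norm f + dual_norm g.
Proof.
apply: dual_norm_le => [|x]; first by rewrite addr_ge0// dual_norm_ge0.
rewrite mulrDl; apply: (le_trans (ler_normD (f x) (g x))).
by rewrite lerD// ler_dual_norm.
Qed.

Lemma dual_normZ (a : R) (f : dual) : dual_norm (a *: f) = `|a| * dual_norm f.
Proof.
have le b g : dual_norm (b *: g) <= `|b| * dual_norm g.
  apply: dual_norm_le => [|x]; first by rewrite mulr_ge0// dual_norm_ge0.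
  by rewrite [X in `|X|]/(b * g x) normrM -mulrA ler_wpM2l// ler_dual_norm.
apply/eqP; rewrite eq_le le/=.
have [->|a0] := eqVneq a 0; first by rewrite normr0 mul0r dual_norm_ge0.
rewrite -ler_pdivlMl ?normr_gt0// -normfV.
by have := le a^-1 (a *: f); rewrite scalerA mulVf// scale1r.
Qed.

Lemma dual_norm0_eq0 (f : dual) : dual_norm f = 0 -> f = 0.
Proof.
move=> f0; apply: dual_eqP => x; apply/eqP; rewrite -normr_le0.
by have := ler_dual_norm f x; rewrite f0 mul0r.
Qed.

HB.instance Definition _ :=
  @Lmodule_isNormed.Build R dual dual_norm dual_normD dual_normZ dual_norm0_eq0.

Definition duality (x : V) (f : dual) : R := f x.

(** The weak-star topology is the topology of pointwise convergence on [V]. *)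
Definition weak_star : Type :=
  initial_topology (fun f : dual => (f : {ptws V -> R^o})).

HB.instance Definition _ := Topological.on weak_star.

End Dual.

Notation bidual V := (dual (dual V)).

Section CanonicalEmbedding.
Context {R : realType} (V : normedModType R).

Definition evaluation (x : V) : dual V -> R^o := fun f => f x.

Lemma evaluation_linear (x : V) : linear (evaluation x).
Proof. by []. Qed.

HB.instance Definition _ (x : V) :=
  GRing.isLinear.Build R (dual V) R^o *:%R (evaluation x) (evaluation_linear x).

Lemma evaluationP (x : V) :
  evaluation x \in @continuous_linear_form R (dual V).
Proof.
apply/asboolP; split; first exact: evaluation_linear.
apply: bounded_linear_continuous; apply/linear_boundedP.
near=> r => f; rewrite /evaluation mulrC.
apply: (le_trans (ler_dual_norm f x)).
rewrite [X in _ <= X](_ : _ = dual_norm f * r)//.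
by apply: ler_wpM2l; [exact: dual_norm_ge0|near: r; exact: nbhs_pinfty_ge].
Unshelve. all: by end_near. Qed.

Definition canonical_embedding (x : V) : bidual V := Dual (evaluationP x).

End CanonicalEmbedding.

(** * Monotone operators

  A set-valued operator from [E] to [F] is represented by its graph,
  a [set (E * F)]. *)

Section Monotone.
Context {R : realType} {E F : zmodType} (pairing : E -> F -> R).

Definition monotone (G : set (E * F)) : Prop :=
  forall u v, G u -> G v -> 0 <= pairing (u.1 - v.1) (u.2 - v.2).

Definition maximally_monotone (G : set (E * F)) : Prop :=
  monotone G /\ forall H, monotone H -> G `<=` H -> H = G.

End Monotone.

(** [tails le] is the filter of tails of a directed set, so that
  [a @ tails le --> l] is the convergence of the net [a] to [l]. *)

Definition directed_set (I : Type) (le : I -> I -> Prop) : Prop :=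
  [/\ inhabited I,
      forall i, le i i,
      forall i j k, le i j -> le j k -> le i k &
      forall i j, exists k, le i k /\ le j k].

Definition tails (I : Type) (le : I -> I -> Prop) : set_system I :=
  filter_from setT (fun i => [set j | le i j]).

Section Operators.
Context {R : realType} {V : normedModType R}.
Implicit Type G : set (V * dual V).

Definition maximally_monotone_operator G : Prop :=
  maximally_monotone (@duality R V) G.

Definition linear_relation G : Prop :=
  G 0 /\ forall (c : R) u v, G u -> G v -> G (c *: u + v).

Definition skew_operator G : Prop := forall u, G u -> duality u.1 u.2 = 0.

Definition type_D G : Prop :=
  forall (x : bidual V) (x' : dual V),
    (0 <= ereal_inf [set (duality (a.2 - x')
                            (canonical_embedding a.1 - x))%:E | a in G])%E ->
    exists (I : Type) (le : I -> I -> Prop) (a : I -> V * dual V),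
      [/\ directed_set le,
          forall i, G (a i),
          exists M : R, forall i, `|(a i).1| <= M /\ `|(a i).2| <= M,
          canonical_embedding (a i).1 @[i --> tails le] -->
            (x : weak_star (dual V)) &
          (a i).2 @[i --> tails le] --> x'].

Definition type_BR G : Prop :=
  forall (x : V) (x' : dual V) (alpha beta : R), 0 < alpha -> 0 < beta ->
    ((- (alpha * beta))%:E <
      ereal_inf [set (duality (x - a.1) (x' - a.2))%:E | a in G])%E ->
    exists b, [/\ G b, `|x - b.1| < alpha & `|x' - b.2| < beta].

Definition bidual_extension G (H : set (bidual V * dual V)) : Prop :=
  maximally_monotone (fun x x' => duality x' x) H /\
  forall a, G a -> H (canonical_embedding a.1, a.2).

Definition unique_operator G : Prop :=
  forall H K, bidual_extension G H -> bidual_extension G K -> H = K.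

End Operators.

Definition space_of_type_D {R : realType} (V : normedModType R) : Prop :=
  forall G : set (V * dual V), maximally_monotone_operator G -> type_D G.

Definition contains_copy {R : realType} (Y X : normedModType R) : Prop :=
  exists (T : {linear X -> Y}) (c C : R),
    [/\ 0 < c, 0 < C & forall x, c * `|x| <= `|T x| <= C * `|x|].

(** * Schauder bases and the operator they induce

  Bases are indexed from 0; the formulas below only depend on the order of
  the index set. *)

Section Basis.
Context {R : realType} {X : normedModType R}.

Definition schauder_basis (e : nat -> X) (e' : nat -> dual X) : Prop :=
  [/\ forall x : X, exists! alpha : nat -> R,
        series (fun n => alpha n *: e n) @ \oo --> x,
      forall x : X, series (fun n => duality x (e' n) *: e n) @ \oo --> x &
      forall i j, duality (e i) (e' j) = (i == j)%:R].

Definition annihilator (ebar : bidual X) : set (dual X) :=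
  [set y | duality y ebar = 0].

Definition gra_coef (e : nat -> X) (y : dual X) (n : nat) : R :=
  - limn (fun m => \sum_(n.+1 <= i < m) duality (e i) y)
  + \sum_(0 <= i < n) duality (e i) y.

(** For [y] in [annihilator ebar] the inner series in [gra_coef] converges as
  soon as the partial sums of [e] converge weak-star to [ebar]; the outer one
  is required to converge to the first component. *)
Definition gra_A (e : nat -> X) (ebar : bidual X) : set (X * dual X) :=
  [set p | annihilator ebar p.2 /\
           series (fun n => gra_coef e p.2 n *: e n) @ \oo --> p.1].

End Basis.

(* Main.v *)
From HB Require Import structures.
Require Import Defs.
From mathcomp Require Import all_boot all_order all_algebra.
From mathcomp Require Import all_classical all_reals all_analysis.
From mathcomp Require Import ring lra.

Set Implicit Arguments.
Unset Strict Implicit.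
Unset Printing Implicit Defensive.

Import Order.TTheory GRing.Theory Num.Theory.
Import numFieldNormedType.Exports.

Local Open Scope classical_set_scope.
Local Open Scope ring_scope.

(** Write [S_n y] for the sum of the [y (e i)] over [i < n]; weak-star
convergence says that [S_n y] tends to [ebar y]. In coordinates, the graph [A]
consists of the [(x, y)] such that [ebar y = 0] and
[e' n x = S_n y + S_(n+1) y] for all [n] ([gra_A_coord]). If more generally
[e' n x = S_n y + S_(n+1) y - c], then the series for [y x] telescopes, because
[y (e n) = S_(n+1) y - S_n y], and its sum is [(ebar y)^2 - c * ebar y]
([pairing_coord]). For [c = 0] this gives skewness.

A point [(x, y)] that is monotonically related to the linear skew relation [A]
satisfies [b x + y a = 0] for every [(a, b)] in [A]. Testing this on the pairs
[(e j + e (j+1), e' j - e' (j+1))] shows that [e' j x - S_j y - S_(j+1) y] does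
not depend on [j]. The coordinates of [x] tend to [0], as the norms of the
[e n] are eventually bounded below, so this constant is [- 2 * ebar y], and
[y x = - (ebar y)^2]. As [(0, 0)] lies in [A], also [0 <= y x]; hence
[ebar y = 0] and [(x, y)] lies in [A]. This is maximality ([gra_A_related]).

The three negative results exploit that [ebar] vanishes on the range of [A] but
takes the value [1] at [e' 0], so that [e' 0] lies at positive distance from
that range. For type (BR), the differences between [(- e 0, e' 0)] and the
elements of [A] all have pairing [-1]. In the bidual, this is compensated by
adding [ebar] to the first component: [(ebar - e 0, e' 0)] is monotonically
related to [A], which contradicts type (D). Another point related to [A] is
[(2 ebar, 0)]; the two are not related to each other, so that maximal extensions
containing them differ.

Finally, being a space of type (D) passes to isomorphic copies of subspaces
([space_of_type_D_copy]): along an embedding [T] a maximally monotone graph on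
[X] is pushed to the graph of all [(T x, z)] with [(x, T' z)] in it, where [T']
is the adjoint. The Hahn-Banach theorem makes this graph maximal (a vector
annihilated by the kernel of [T'] lies in the range of [T]) and allows one to
pull type (D) back (the adjoint is onto). *)

(** * Hahn-Banach theorem *)

Section HahnBanach.
Context {R : realType} {V : lmodType R}.
Implicit Types (p q : V -> R) (x y : V).

Definition sublinear p :=
  (forall x y, p (x + y) <= p x + p y) /\
  (forall t x, 0 <= t -> p (t *: x) <= t * p x).

Lemma sublinear_le0 p : sublinear p -> p 0 <= 0.
Proof. by move=> [_ pZ]; have := pZ 0 0 (lexx 0); rewrite scale0r mul0r. Qed.

Lemma sublinear_opp p x : sublinear p -> - p (- x) <= p x.
Proof.
move=> [pD pZ].
have := pD 0 0; have := pD x (- x); rewrite addr0 subrr => h1 h2.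
by rewrite lerNl -subr_ge0 opprK; lra.
Qed.

Lemma sublinearZ p t x : sublinear p -> 0 <= t -> p (t *: x) = t * p x.
Proof.
move=> sp; have [pD pZ] := sp; rewrite le_eqVlt => /predU1P[<-|t0].
  rewrite scale0r mul0r; apply/eqP; rewrite eq_le sublinear_le0//=.
  by have := pD 0 0; rewrite addr0; lra.
apply/eqP; rewrite eq_le pZ/= ?(ltW t0)//.
rewrite -ler_pdivlMl//.
have := pZ t^-1 (t *: x); rewrite scalerA mulVf ?gt_eqF// scale1r.
by rewrite invr_ge0 (ltW t0) => ->.
Qed.

(** The pointwise infimum of a family that is only jointly sublinear: each
inequality may be paid for by moving to another index. It serves for chains, for
the functionals of [sublinear_lower] and for the extension of functionals. *)
Lemma sublinear_inf (I : Type) (P : set I) (F : I -> V -> R) p :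
  P !=set0 ->
  (forall i, P i -> forall x, - p (- x) <= F i x) ->
  (forall i j, P i -> P j -> forall x y,
     exists2 k, P k & F k (x + y) <= F i x + F j y) ->
  (forall i t x, P i -> 0 < t ->
     exists2 k, P k & F k (t *: x) <= t * F i x) ->
  (forall d, 0 < d -> exists2 k, P k & F k 0 <= d) ->
  let q x := inf [set F i x | i in P] in
  sublinear q /\ forall i, P i -> forall x, q x <= F i x.
Proof.
move=> P0 Fp FD FZ F0 q.
have lbF x : has_lbound [set F i x | i in P].
  by exists (- p (- x)) => _ [i Pi <-]; exact: Fp.
have qF i : P i -> forall x, q x <= F i x.
  by move=> Pi x; apply: ge_inf => //; exists i.
have qadh x d : 0 < d -> exists2 i, P i & F i x < q x + d.
  move=> d0; have [|_ [i Pi <-] Fi] := @inf_adherent _ [set F i x | i in P] _ d0.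
    by split=> //; case: P0 => i Pi; exists (F i x), i.
  by exists i.
split=> //; split=> [x y|t x].
  apply/ler_addgt0Pr => d d0; have d2 : 0 < d / 2 by rewrite divr_gt0.
  have [i Pi Fi] := qadh x _ d2; have [j Pj Fj] := qadh y _ d2.
  have [k Pk Fk] := FD i j Pi Pj x y.
  by have := qF k Pk (x + y); lra.
rewrite le_eqVlt => /predU1P[<-|t0].
  rewrite scale0r mul0r; apply/ler_addgt0Pr => d d0; rewrite add0r.
  by have [k Pk Fk] := F0 d d0; exact: le_trans (qF k Pk 0) Fk.
apply/ler_addgt0Pr => d d0; have dt : 0 < d / t by rewrite divr_gt0.
have [i Pi Fi] := qadh x _ dt; have [k Pk Fk] := FZ i t x Pi t0.
apply: le_trans (qF k Pk _) _; apply: le_trans Fk _.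
rewrite -[leRHS](_ : t * (q x + d / t) = _); first by rewrite ler_pM2l// ltW.
by field; rewrite gt_eqF.
Qed.

(** The functional [x |-> inf_(t >= 0) (p (x + t y) - t p y)] lies below [p]
and is at most [- p y] at [- y], so a linear functional below it takes the
value [p y] at [y]. A minimal sublinear functional must coincide with the one
built from it, for every [y], which forces it to be odd. *)
Lemma sublinear_lower p y : sublinear p ->
  exists q, [/\ sublinear q, forall x, q x <= p x & q (- y) <= - p y].
Proof.
move=> sp; have [pD pZ] := sp; have p0 := sublinear_le0 sp.
pose F t x := p (x + t *: y) - t * p y.
have [|||||sq qF] := @sublinear_inf R [set t | 0 <= t] F p.
- by exists 0; exact: lexx.
- move=> t /= t0 x; rewrite /F -(sublinearZ y sp t0).
  by have := pD (x + t *: y) (- x); rewrite addrAC subrr add0r; lra.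
- move=> s t /= s0 t0 x z; exists (s + t) => /=; first by rewrite addr_ge0.
  rewrite /F scalerDl addrACA mulrDl.
  by have := pD (x + s *: y) (z + t *: y); lra.
- move=> s t x /= s0 t0; exists (t * s) => /=; first by rewrite mulr_ge0// ltW.
  rewrite /F -scalerA -scalerDr -mulrA mulrBr lerD2r; exact: pZ (ltW t0).
- move=> d d0; exists 0 => //=; rewrite /F scale0r mul0r !addr0 subr0.
  exact: le_trans p0 (ltW d0).
exists (fun x => inf [set F t x | t in [set t | 0 <= t]]); split=> //.
- by move=> x; have := qF 0 (lexx 0) x; rewrite /F scale0r mul0r addr0 subr0.
- have := qF 1 ler01 (- y); rewrite /F scale1r mul1r addNr => h.
  by apply: le_trans h _; lra.
Qed.

(** Below [p], Zorn's lemma gives a minimal sublinear functional. It is odd by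
[sublinear_lower], and an odd sublinear functional is linear. *)
Lemma hahn_banach p y : sublinear p ->
  exists f : V -> R^o, [/\ linear f, forall x, f x <= p x & f y = p y].
Proof.
move=> sp; have [p1 [sp1 p1p p1y]] := sublinear_lower y sp.
(* The order on [T] is reversed: Zorn's lemma yields a minimal functional. *)
pose T := {q : V -> R | sublinear q /\ forall x, q x <= p1 x}.
pose le (q r : T) := `[< forall x, sval r x <= sval q x >].
pose mk q sq qp : T := exist _ q (conj sq qp).
have [||||[q [sq qp1]] qmin] := @Zorn T le.
- by move=> q; apply/asboolP.
- move=> q r s /asboolP qr /asboolP rs; apply/asboolP => x.
  exact: le_trans (rs x) (qr x).
- move=> [q qP] [r rP] /asboolP qr /asboolP rq; apply: eq_exist.
  by apply/funext => x; apply/eqP; rewrite eq_le qr rq.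
- move=> A totA; have [A0|/set0P[a Aa]] := eqVneq A set0.
    by exists (mk p1 sp1 (fun x => lexx _)) => s; rewrite A0.
  have [|||||sq qF] := @sublinear_inf T A (fun i => sval i) p1.
  + by exists a.
  + move=> [i [si ip]] _ x /=.
    by apply: le_trans (sublinear_opp x si); rewrite lerN2.
  + move=> i j Ai Aj x z; have [/asboolP ij|/asboolP ji] := totA i j Ai Aj.
      exists j => //; apply: le_trans ((svalP j).1.1 _ _) _; exact: lerD.
    exists i => //; apply: le_trans ((svalP i).1.1 _ _) _; exact: lerD.
  + by move=> i t x Ai t0; exists i => //; apply: (svalP i).1.2; exact: ltW.
  + move=> d d0; exists a => //; apply: le_trans (ltW d0).
    exact: sublinear_le0 (svalP a).1.
  have qp x : inf [set sval i x | i in A] <= p1 x.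
    exact: le_trans (qF a Aa x) ((svalP a).2 x).
  exists (mk _ sq qp) => s As.
  by apply/asboolP => x /=; exact: qF.
have qopp x : q (- x) <= - q x.
  have [r [sr rq rx]] := sublinear_lower x sq.
  have rp1 z : r z <= p1 z by exact: le_trans (rq z) (qp1 z).
  have := qmin (mk r sr rp1).
  have -> : le (mk q sq qp1) (mk r sr rp1).
    exact/asboolP.
  by move=> /(_ isT) /(congr1 sval)/= rqE; rewrite -{1}rqE.
have qN x : q (- x) = - q x.
  apply/eqP; rewrite eq_le qopp/=; have := sublinear_opp x sq.
  by rewrite lerNl.
have [qD qZ] := sq.
have qDE x z : q (x + z) = q x + q z.
  apply/eqP; rewrite eq_le qD/=; have := qD (x + z) (- z).
  by rewrite addrK qN; lra.
have qZ_ge0 t x : 0 <= t -> q (t *: x) = t * q x.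
  exact: sublinearZ.
exists q; split.
- move=> t x z /=; rewrite qDE; congr (_ + _).
  have [t0|t0] := leP 0 t; first exact: qZ_ge0.
  have -> : t *: x = - ((- t) *: x) by rewrite scaleNr opprK.
  by rewrite qN qZ_ge0 ?oppr_ge0 1?ltW// mulNr opprK.
- by move=> x; exact: le_trans (qp1 x) (p1p x).
- apply/eqP; rewrite eq_le (le_trans (qp1 y) (p1p y))/=.
  by have := le_trans (qp1 (- y)) p1y; rewrite qN lerN2.
Qed.

End HahnBanach.

(** * Bounded functionals and weak-star convergence *)

Section Duality.
Context {R : realType} {V : normedModType R}.
Implicit Types (x a : V) (y b : dual V).

Lemma dualityBB x a y b : duality (x - a) (y - b) =
  duality x y - duality a y - (duality x b - duality a b).
Proof.
rewrite /duality linearB.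
by change (y x - b x - (y a - b a) = y x - y a - (b x - b a) :> R); ring.
Qed.

Lemma dualityZl t x y : duality (t *: x) y = t * duality x y.
Proof. by rewrite /duality linearZ. Qed.

Lemma dualityZr t x y : duality x (t *: y) = t * duality x y.
Proof. by []. Qed.

Lemma dualityNl x y : duality (- x) y = - duality x y.
Proof. by rewrite /duality linearN. Qed.

Lemma dualityNN x y : duality (- x) (- y) = duality x y.
Proof. by rewrite dualityNl; exact: opprK. Qed.

End Duality.

(** The constructor by which concrete elements of the dual are built. *)
Lemma bounded_linear_form (R : realType) (V : normedModType R)
    (f : V -> R^o) (C : R) :
  linear f -> (forall x, `|f x| <= C * `|x|) ->
  f \in @continuous_linear_form R V.
Proof.
move=> lf fC; apply/asboolP; split=> //.
pose fL : {linear V -> R^o} :=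
  HB.pack f (GRing.isLinear.Build R V R^o *:%R f lf).
apply: (@bounded_linear_continuous _ _ _ fL); apply/linear_boundedP.
near=> r => x; apply: le_trans (fC x) _; exact: ler_wpM2r.
Unshelve. all: by end_near. Qed.

Lemma weak_star_cvgP (R : realType) (V : normedModType R) (I : Type)
    (F : set_system I) (phi : I -> dual V) (x : dual V) : Filter F ->
  phi i @[i --> F] --> (x : weak_star V) <->
  forall v, phi i v @[i --> F] --> x v.
Proof.
move=> FF; pose val := fun f : dual V => (f : {ptws V -> R^o}).
have -> : (phi i @[i --> F] --> (x : weak_star V)) =
          (val (phi i) @[i --> F] --> val x).
  apply/propext; split=> [cvx|cvx A].
    exact: (@cvg_comp _ _ _ phi val _ _ _ cvx (@initial_continuous _ _ _ _)).
  move=> /= [_ [[B Bop <-] Bx BA]]; apply: filterS BA _.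
  by apply: cvx; exact: open_nbhs_nbhs.
split=> [/pointwise_cvgP|cvx]; first by [].
exact/pointwise_cvgP.
Qed.

Lemma tails_filter (I : Type) (le : I -> I -> Prop) :
  directed_set le -> ProperFilter (tails le).
Proof.
move=> [[i0] le_refl le_trans le_dir]; apply: filter_from_proper.
  apply: filter_from_filter; first by exists i0.
  move=> i j _ _; have [k [ik jk]] := le_dir i j.
  by exists k => // l kl; split; exact: le_trans kl.
by move=> i _; exists i; exact: le_refl.
Qed.

Section Extension.
Context {R : realType} {X Y : normedModType R} (T : {linear X -> Y}).

(** The functional [p z = inf_x (C * |z - T x| + g x)] is sublinear, at most
[C * |z|], and at most [g x] at [T x]; a linear functional below it is therefore
bounded and restricts to [g] along [T]. For [g = 0] and [C = 1] the prescribed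
value at [y] is the distance from [y] to the range of [T], so the statement
contains both the extension and the separation form of Hahn-Banach. *)
Lemma dual_extension (g : dual X) (C : R) (y : Y) : 0 <= C ->
    (forall x, `|g x| <= C * `|T x|) ->
  exists f : dual Y, (forall x, f (T x) = g x) /\
    f y = inf [set C * `|y - T x| + g x | x in [set: X]].
Proof.
move=> C0 gC.
pose F x z := C * `|z - T x| + g x.
have gge x : - (C * `|T x|) <= g x by have := gC x; rewrite ler_norml => /andP[].
have [|||||sp pF] := @sublinear_inf R Y X setT F (fun z => C * `|z|).
- by exists 0.
- move=> x _ z; rewrite /F normrN.
  have : `|T x| <= `|z - T x| + `|z|.
    by rewrite distrC; apply: le_trans (ler_normD _ _); rewrite subrK.
  by move=> /(ler_wpM2l C0); have := gge x; rewrite mulrDr; lra.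
- move=> x x' _ _ z z'; exists (x + x') => //; rewrite /F !linearD/=.
  have : `|z + z' + (- T x - T x')| <= `|z - T x| + `|z' - T x'|.
    by rewrite addrACA ler_normD.
  move=> /(ler_wpM2l C0); rewrite mulrDr; lra.
- move=> x t z _ t0; exists (t *: x) => //; rewrite /F !linearZ/=.
  rewrite -scalerDr normrZ gtr0_norm// mulrDr mulrCA.
  exact: lexx.
- move=> d d0; exists 0 => //; rewrite /F !linear0 !addr0 normr0 mulr0.
  exact: ltW.
have [f [lf fp fy]] := hahn_banach y sp.
have fN z : f (- z) = - f z.
  have f0 : f 0 = 0.
    have := lf 1 0 0; rewrite !scale1r addr0.
    by move=> /(congr1 (fun r => r - f 0)); rewrite addrK subrr.
  by have := lf (-1) z 0; rewrite !scaleN1r f0 !addr0.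
have fF x z : f z <= F x z by exact: le_trans (fp z) (pF x I z).
have fC z : `|f z| <= C * `|z|.
  have fle w : f w <= C * `|w|.
    by have := fF 0 w; rewrite /F !linear0 !addr0.
  by rewrite ler_norml fle andbT lerNl -fN -(normrN z) fle.
exists (Dual (bounded_linear_form lf fC)); split=> // x /=.
have fle w : f (T w) <= g w.
  by have := fF w (T w); rewrite /F subrr normr0 mulr0 add0r.
apply/eqP; rewrite eq_le fle/= -lerN2 -fN -[- g x]linearN -linearN.
exact: fle.
Qed.

End Extension.

Section Adjoint.
Context {R : realType} {X Y : normedModType R} (T : {linear X -> Y}) (C : R).
Hypothesis (C0 : 0 <= C) (TC : forall x, `|T x| <= C * `|x|).

Let comp_linear (z : dual Y) : linear (fun x => z (T x) : R^o).
Proof. by move=> t x x'; rewrite !linearP. Qed.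

Let comp_bound (z : dual Y) x : `|z (T x)| <= C * `|z| * `|x|.
Proof.
apply: le_trans (ler_dual_norm z (T x)) _.
rewrite (mulrC C) -mulrA; apply: ler_wpM2l (TC x); exact: dual_norm_ge0.
Qed.

Definition adjoint (z : dual Y) : dual X :=
  Dual (bounded_linear_form (comp_linear z) (comp_bound z)).

Lemma adjoint_norm z : `|adjoint z| <= C * `|z|.
Proof.
by apply: dual_norm_le => [|x]; [rewrite mulr_ge0|exact: comp_bound].
Qed.

Lemma adjoint_is_linear : linear adjoint.
Proof. by move=> t z w; apply: dual_eqP. Qed.

HB.instance Definition _ :=
  GRing.isLinear.Build R (dual Y) (dual X) *:%R adjoint adjoint_is_linear.

End Adjoint.

(** * Monotonically related points *)

(** How a family of inequalities along a line becomes an orthogonality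
relation. *)
Lemma affine_ge0_slope (R : realFieldType) (a b : R) :
  (forall t, 0 <= a - t * b) -> b = 0.
Proof.
move=> ab; apply: contrapT => /eqP b0.
by have := ab ((a + 1) / b); rewrite divfK//; lra.
Qed.

(** The two hypotheses on the pairing hold for both pairings of interest: of
[V] with its dual, and of the bidual with the dual. *)
Section Related.
Context {R : realType} {E F : zmodType} (pairing : E -> F -> R).
Hypothesis pairing0 : pairing 0 0 = 0.
Hypothesis pairingNN : forall x y, pairing (- x) (- y) = pairing x y.
Implicit Types (G H : set (E * F)) (p : E * F).

Definition monotonically_related G p :=
  forall a, G a -> 0 <= pairing (p.1 - a.1) (p.2 - a.2).

Lemma monotone_setU1 G p :
  Defs.monotone pairing G -> monotonically_related G p ->
  Defs.monotone pairing (G `|` [set p]).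
Proof.
move=> Gm Gp u v [Gu|->] [Gv|->].
- exact: Gm.
- by rewrite -pairingNN !opprB; exact: Gp.
- exact: Gp.
- by rewrite !subrr pairing0.
Qed.

(** Otherwise [G] and [p] together would form a proper monotone extension. *)
Lemma maximally_monotone_related G p :
  maximally_monotone pairing G -> monotonically_related G p -> G p.
Proof.
move=> [Gm Gmax] Gp; rewrite -(Gmax _ (monotone_setU1 Gm Gp)); first by right.
by move=> a; left.
Qed.

Lemma related_maximally_monotone G :
  Defs.monotone pairing G -> (forall p, monotonically_related G p -> G p) ->
  maximally_monotone pairing G.
Proof.
move=> Gm Gmax; split=> // H Hm GH; apply/seteqP; split=> // p Hp.
by apply: Gmax => a Ga; apply: Hm => //; exact: GH.
Qed.

Lemma maximal_extension G : Defs.monotone pairing G ->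
  exists H, maximally_monotone pairing H /\ G `<=` H.
Proof.
move=> Gm; pose P := [set H | Defs.monotone pairing (G `|` H)].
(* The sets [H] are taken relative to [G], so that the union of the empty
   chain is also admissible. *)
have [|H [PH Hmax]] := @Zorn_bigcup _ P.
  move=> S SP totS u v.
  have GK K a b : S K -> (G `|` K) a -> (G `|` K) b ->
      0 <= pairing (a.1 - b.1) (a.2 - b.2) by move=> SK; exact: SP SK _ _.
  move=> [Gu|[K SK Ku]] [Gv|[L SL Lv]].
  - exact: Gm.
  - by apply: (GK L) => //; [left|right].
  - by apply: (GK K) => //; [right|left].
  - have [KL|LK] := totS K L SK SL.
      by apply: (GK L) => //; right => //; exact: KL.
    by apply: (GK K) => //; right => //; exact: LK.
exists (G `|` H); split=> [|a]; last by left.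
split=> // K Km GHK; apply: contrapT => KGH; apply: (Hmax K).
  split; first by move=> a Ha; apply: GHK; right.
  move=> KH; apply: KGH; apply/seteqP; split => // a Ka.
  by right; exact: KH.
suff -> : P K = Defs.monotone pairing K by [].
by rewrite /P/=; congr Defs.monotone; apply/setUidr => a Ga; apply: GHK; left.
Qed.

End Related.

(** Each of [p] and [q] belongs to some maximal monotone extension of [G];
uniqueness makes these extensions equal, and monotonicity compares the two
points. *)
Lemma unique_operator_related (R : realType) (V : normedModType R)
    (G : set (V * dual V)) (p q : bidual V * dual V) :
    Defs.monotone (@duality R V) G -> unique_operator G ->
    (forall a, G a -> 0 <= duality (a.2 - p.2) (canonical_embedding a.1 - p.1)) ->
    (forall a, G a -> 0 <= duality (a.2 - q.2) (canonical_embedding a.1 - q.1)) ->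
  0 <= duality (p.2 - q.2) (p.1 - q.1).
Proof.
move=> Gm Guniq Gp Gq.
pose pairing (x : bidual V) (x' : dual V) : R := duality x' x.
pose G2 : set (bidual V * dual V) :=
  [set (canonical_embedding a.1, a.2) | a in G].
have G2m : Defs.monotone pairing G2.
  move=> _ _ [a Ga <-] [b Gb <-].
  change (0 <= duality (a.2 - b.2)
                 (canonical_embedding a.1 - canonical_embedding b.1)).
  by have := Gm a b Ga Gb; rewrite !dualityBB /duality/= /evaluation; lra.
have pairing0 : pairing 0 0 = 0 by [].
have pairingNN x x' : pairing (- x) (- x') = pairing x x' by exact: dualityNN.
have extend (r : bidual V * dual V) :
    (forall a, G a -> 0 <= duality (a.2 - r.2) (canonical_embedding a.1 - r.1)) ->
    exists H, bidual_extension G H /\ H r.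
  move=> Gr; have G2r : monotonically_related pairing G2 r.
    by move=> _ [a Ga <-]; rewrite -pairingNN !opprB; exact: Gr.
  have [H [Hmax GH]] :=
    maximal_extension (monotone_setU1 pairing0 pairingNN G2m G2r).
  exists H; split; last by apply: GH; right.
  by split=> // a Ga; apply: GH; left; exists a.
have [H [GH Hp]] := extend p Gp; have [K [GK Kq]] := extend q Gq.
by apply: GH.1.1 => //; rewrite (Guniq _ _ GH GK).
Qed.

(** * Type (D) and isomorphic copies *)

(** The sets of [x] with [|y - T x| < d] generate a Cauchy filter, as [T] is
bounded below; its limit is mapped to [y]. *)
Lemma closed_range (R : realType) (X : completeNormedModType R)
    (Y : normedModType R) (T : {linear X -> Y}) (c C : R) (y : Y) :
    0 < c -> 0 < C -> (forall x, c * `|x| <= `|T x| <= C * `|x|) ->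
    (forall d, 0 < d -> exists x, `|y - T x| < d) ->
  exists x, y = T x.
Proof.
move=> c0 C0 TcC yT.
pose F := filter_from [set d : R | 0 < d] (fun d => [set x : X | `|y - T x| < d]).
have FF : ProperFilter F.
  apply: filter_from_proper.
    apply: filter_from_filter; first by exists 1 => /=.
    move=> d d' /= d0 d'0; exists (Num.min d d') => /=.
      by rewrite lt_min d0.
    by move=> x /=; rewrite lt_min => /andP[].
  by move=> d /= /yT.
have : cauchy F.
  apply: cauchy_exP => d d0.
  have cd : 0 < c * d / 2 by rewrite divr_gt0// mulr_gt0.
  have [x xy] := yT _ cd; exists x; exists (c * d / 2) => //= z /= zy.
  rewrite -ball_normE /= -(ltr_pM2l c0).
  have /andP[+ _] := TcC (x - z) => /le_lt_trans; apply.
  have -> : T (x - z) = (y - T z) - (y - T x).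
    by rewrite linearB/= opprB [RHS]addrC addrA subrK.
  by rewrite (le_lt_trans (ler_normB _ _))//; lra.
move=> /cauchy_cvg /cvg_ex[l Fl]; exists l; apply/eqP.
rewrite -subr_eq0 -normr_le0; apply/ler_addgt0Pr => d d0; rewrite add0r.
have Cd : 0 < d / (2 * C) by rewrite divr_gt0// mulr_gt0.
have d2 : 0 < d / 2 by rewrite divr_gt0.
have : F (ball l (d / (2 * C)) `&` [set x | `|y - T x| < d / 2]).
  by apply: filterI; [exact: Fl (nbhsx_ballx _ _ Cd)|exists (d / 2)].
move=> /filter_ex[x []]; rewrite -ball_normE/= => lx xy.
have {}lx : `|T (l - x)| <= d / 2.
  have /andP[_] := TcC (l - x) => /le_trans; apply.
  rewrite -ler_pdivlMl// (le_trans (ltW lx))// invfM mulrA.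
  by rewrite [leRHS]mulrC.
rewrite (_ : y - T l = (y - T x) - T (l - x)).
  by rewrite (le_trans (ler_normB _ _))//; lra.
by rewrite linearB/= opprB addrA subrK.
Qed.

Section Transfer.
Context {R : realType} {X : completeNormedModType R} {Y : normedModType R}.
Variables (T : {linear X -> Y}) (c C : R).
Hypotheses (c0 : 0 < c) (C0 : 0 < C).
Hypothesis (TcC : forall x, c * `|x| <= `|T x| <= C * `|x|).

Let TC x : `|T x| <= C * `|x|. Proof. by have /andP[] := TcC x. Qed.

Let T' : {linear dual Y -> dual X} := adjoint TC.

Definition pushforward (G : set (X * dual X)) : set (Y * dual Y) :=
  [set p | exists2 x, p.1 = T x & G (x, T' p.2)].

(** [g] is bounded by a multiple of [|T x|], because [T] is bounded below. *)
Lemma adjoint_surj (g : dual X) : exists z, T' z = g.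
Proof.
have gC x : `|g x| <= `|g| / c * `|T x|.
  apply: le_trans (ler_dual_norm g x) _; rewrite -mulrA.
  apply: ler_wpM2l; first exact: dual_norm_ge0.
  by rewrite ler_pdivlMl//; have /andP[] := TcC x.
have [|z [zT _]] := @dual_extension _ _ _ T g _ 0 _ gC.
  by rewrite divr_ge0// ltW.
by exists z; apply: dual_eqP.
Qed.

(** The extension of the zero functional whose value at [y] is the distance
from [y] to the range of [T] vanishes at [y] by hypothesis. *)
Lemma range_separation (y : Y) :
  (forall z : dual Y, T' z = 0 -> z y = 0) -> exists x, y = T x.
Proof.
move=> Ty; apply: (closed_range c0 C0 TcC) => d d0.
have [|z [zT zy]] := @dual_extension _ _ _ T 0 1 y ler01.
  by move=> x; rewrite normr0 mul1r.
have : z y = 0 by apply: Ty; apply: dual_eqP.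
rewrite {}zy; set E := (X in inf X) => inf0.
have [|r [x _ <-]] := @inf_adherent R E d d0.
  split; first by exists (1 * `|y - T 0| + (0 : dual X) 0), 0.
  by exists 0 => _ [x _ <-]; rewrite mul1r addr0.
by rewrite inf0 add0r mul1r addr0; exists x.
Qed.

(** For a related point [(y, z)] and a point [(T a, w0)] of the graph, all
[(T a, w0 + t w)] with [w] in the kernel of the adjoint are in the graph too,
so that [w] vanishes at [y - T a] and [y] is in the range of [T]. Related points
are then of the form [(T x, z)], and maximality of [G] applies to
[(x, T' z)]. *)
Lemma pushforward_maximal (G : set (X * dual X)) :
  maximally_monotone_operator G -> maximally_monotone_operator (pushforward G).
Proof.
move=> Gmax; have Gm := Gmax.1.
have pushE x x' (z z' : dual Y) :
    duality (T x - T x') (z - z') = duality (x - x') (T' z - T' z').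
  by rewrite -linearB -(linearB T').
have duality0 : @duality R X 0 0 = 0 by [].
have G_related := maximally_monotone_related duality0 (@dualityNN R X) Gmax.
apply: related_maximally_monotone.
  move=> [_ z] [_ z'] [x /= -> Gx] [x' /= -> Gx'].
  have : 0 <= duality (x - x') (T' z - T' z') := Gm _ _ Gx Gx'.
  by rewrite -pushE.
move=> [y z] yz.
have [[a a'] Ga] : exists a, G a.
  have [G0|/set0P//] := eqVneq G set0.
  by exists 0; apply: G_related => a; rewrite G0.
have [w0 w0a] := adjoint_surj a'.
have [x yx] : exists x, y = T x.
  have [x yx] : exists x, y - T a = T x.
    apply: range_separation => w Tw.
    apply: (@affine_ge0_slope _ ((z - w0) (y - T a))) => t.
    have : pushforward G (T a, w0 + t *: w).
      by exists a => //=; rewrite linearD linearZ/= Tw scaler0 addr0 w0a.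
    by move=> /yz; rewrite /duality/= opprD addrA.
  by exists (x + a); rewrite linearD -yx subrK.
exists x => //; apply: G_related => -[b b'].
have [w <-] := adjoint_surj b' => Gb.
have : 0 <= duality (T x - T b) (z - w).
  by rewrite -yx; apply: (yz (T b, w)); exists b.
by rewrite pushE.
Qed.

(** A point [(phi, x')] of the bidual is moved to [(phi o T', z')], where
[T' z' = x']. The net obtained for it has the form [(T (x i), z i)], and
[(x i, T' (z i))] is the net sought: it is bounded as [T] is bounded below, and
its first component converges weak-star as [T'] is onto. *)
Lemma type_D_pushforward (G : set (X * dual X)) :
  type_D (pushforward G) -> type_D G.
Proof.
move=> DG phi x' /ereal_infP phi_ge0.
have [z' z'x'] := adjoint_surj x'.
have psi_lin : linear (phi \o T' : dual Y -> R^o).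
  by move=> t z w /=; rewrite !linearP.
have psi_bound z : `|phi (T' z)| <= `|phi| * C * `|z|.
  apply: le_trans (ler_dual_norm phi _) _; rewrite -mulrA.
  apply: ler_wpM2l; first exact: dual_norm_ge0.
  exact: adjoint_norm (ltW C0) TC z.
pose psi : bidual Y := Dual (bounded_linear_form psi_lin psi_bound).
have [|I [le [b [Idir Gb [M bM] b1 b2]]]] := DG psi z'.
  apply/ereal_infP => _ [[_ z] [x /= -> Gx] <-].
  apply: phi_ge0; exists (x, T' z) => //=.
  by rewrite -z'x' -linearB.
have /choice[x bx] : forall i, exists x, (b i).1 = T x /\ G (x, T' (b i).2).
  by move=> i; have [x] := Gb i; exists x.
have ? := tails_filter Idir.
exists I, le, (fun i => (x i, T' (b i).2)); split => //.
- by move=> i; case: (bx i).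
- exists (M / c + C * M) => i /=; have [b1M b2M] := bM i.
  have M0 : 0 <= M by exact: le_trans (normr_ge0 _) b1M.
  have Mc : 0 <= M / c by rewrite divr_ge0// ltW.
  have CM : 0 <= C * M by rewrite mulr_ge0// ltW.
  split.
    have : `|x i| <= M / c; last by lra.
    rewrite ler_pdivlMr// mulrC; apply: le_trans b1M.
    by rewrite (bx i).1; have /andP[] := TcC (x i).
  apply: le_trans (adjoint_norm (ltW C0) TC _) _.
  have : C * `|(b i).2| <= C * M by rewrite ler_pM2l.
  by lra.
- apply/weak_star_cvgP => f; have [w wf] := adjoint_surj f.
  move/weak_star_cvgP : b1 => /(_ w) /=; rewrite wf.
  apply: cvg_trans; apply: near_eq_cvg; near=> i => /=.
  by rewrite /evaluation (bx i).1 -wf.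
- apply/cvgrPdist_lt => d d0 /=.
  have dC : 0 < d / C by rewrite divr_gt0.
  move/cvgrPdist_lt : b2 => /(_ _ dC); apply: filterS => i bi.
  rewrite -z'x' -linearB; apply: le_lt_trans (adjoint_norm (ltW C0) TC _) _.
  by rewrite -ltr_pdivlMl// mulrC.
Unshelve. all: by end_near. Qed.

End Transfer.

Theorem space_of_type_D_copy (R : realType) (X : completeNormedModType R)
    (Y : normedModType R) :
  contains_copy Y X -> space_of_type_D Y -> space_of_type_D X.
Proof.
move=> [T [c [C [c0 C0 TcC]]]] DY G Gmax.
apply: (type_D_pushforward c0 C0 (TcC := TcC)); apply: DY.
exact: pushforward_maximal.
Qed.

(** * The operator of a Schauder basis *)

Lemma limn_einf_gt0 (R : realType) (u : nat -> R) :
  (0 < limn_einf (fun n => (u n)%:E))%E ->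
  exists2 c, 0 < c & \forall n \near \oo, c <= u n.
Proof.
rewrite limn_einf_lim (cvg_lim _ (@cvg_einfs_sup _ _))// => /ereal_sup_gt.
move=> [_ [N _ <-]]; rewrite /einfs/=.
set m := ereal_inf _ => m0.
have mu n : (N <= n)%N -> (m <= (u n)%:E)%E.
  by move=> Nn; apply: ereal_inf_lbound; exists n.
have mfin : m \is a fin_num.
  rewrite fin_numE -ltNye -ltey (lt_trans _ m0)//=.
  by rewrite (le_lt_trans (mu N _))// ltry.
exists (fine m); first by rewrite fine_gt0// m0/= -ge0_fin_numE// ltW.
by exists N => // n /= Nn; rewrite -lee_fin fineK// mu.
Qed.

Section Basis.
Context {R : realType} {X : completeNormedModType R}.
Variables (e : nat -> X) (e' : nat -> dual X) (ebar : bidual X).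
Hypothesis basis : schauder_basis e e'.
Hypothesis e_cvg : canonical_embedding (\sum_(0 <= i < n) e i) @[n --> \oo] -->
  (ebar : weak_star (dual X)).
Implicit Types (x : X) (y : dual X).

Let S y (n : nat) : R := \sum_(0 <= i < n) y (e i).
Let A := gra_A e ebar.

Lemma partial_sumS y n : S y n.+1 = S y n + y (e n).
Proof. by rewrite /S big_nat_recr. Qed.

Lemma partial_sum0 y : S y 0 = 0.
Proof. by rewrite /S big_geq. Qed.

Lemma partial_sum_cvg y : S y n @[n --> \oo] --> (ebar y : R).
Proof.
have /weak_star_cvgP/(_ y) := e_cvg; apply: cvg_trans.
apply: near_eq_cvg; near=> n.
by rewrite /= /evaluation raddf_sum.
Unshelve. all: by end_near. Qed.

(** The tail series in [gra_coef] sums to [ebar y - S y n.+1]. *)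
Lemma gra_coefE y n : gra_coef e y n = S y n + S y n.+1 - ebar y.
Proof.
rewrite /gra_coef; set l := limn _.
have -> : l = ebar y - S y n.+1; last by rewrite -/(S y n); ring.
apply/cvg_lim => //.
have : S y m - S y n.+1 @[m --> \oo] --> (ebar y - S y n.+1 : R).
  by apply: cvgB; [exact: partial_sum_cvg|exact: cvg_cst].
apply: cvg_trans; apply: near_eq_cvg; near=> m.
rewrite /S (@big_cat_nat _ _ _ n.+1 0 m)//=; last first.
  by near: m; exact: nbhs_infty_ge.
by rewrite [in LHS]addrAC subrr add0r.
Unshelve. all: by end_near. Qed.

Lemma basis_coordE x (alpha : nat -> R) :
  series (fun n => alpha n *: e n) @ \oo --> x <->
  forall n, alpha n = e' n x.
Proof.
have [uniq expand _] := basis; have [alpha0 [_ alpha0_uniq]] := uniq x.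
split=> [/alpha0_uniq alphaE n|alphaE].
  by rewrite -alphaE (alpha0_uniq _ (expand x)).
have := expand x; rewrite (_ : alpha = fun n => duality x (e' n))//.
exact/funext.
Qed.

Lemma gra_A_coord x y :
  A (x, y) <-> ebar y = 0 /\ forall n, e' n x = S y n + S y n.+1.
Proof.
rewrite /A /gra_A /annihilator/=; split=> -[ey].
  move=> /basis_coordE yx; split=> // n.
  by rewrite -yx gra_coefE (ey : ebar y = 0) subr0.
by move=> yx; split=> //; apply/basis_coordE => n; rewrite yx gra_coefE ey subr0.
Qed.

(** Since [y (e n) = S y n.+1 - S y n], the terms of the series of [y x] are
the increments of [S y n ^+ 2 - c * S y n]. *)
Lemma pairing_coord x y c :
  (forall n, e' n x = S y n + S y n.+1 - c) ->
  y x = ebar y ^+ 2 - c * ebar y.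
Proof.
move=> xE; have [_ expand _] := basis.
have yx : S y n ^+ 2 - c * S y n @[n --> \oo] --> (y x : R).
  have : y (series (fun n => duality x (e' n) *: e n) n) @[n --> \oo] --> y x.
    exact: continuous_cvg (@dual_continuous _ _ y x) (expand x).
  apply: cvg_trans; apply: near_eq_cvg; near=> n.
  rewrite /series /= raddf_sum/=.
  rewrite (telescope_sumr_eq (fun n => S y n ^+ 2 - c * S y n))//.
    by rewrite partial_sum0; ring.
  move=> k _; rewrite linearZ/= [duality _ _]xE partial_sumS /GRing.scale/=; ring.
have yl : S y n ^+ 2 - c * S y n @[n --> \oo] --> (ebar y ^+ 2 - c * ebar y : R).
  apply: cvgB; last by apply: cvgM; [exact: cvg_cst|exact: partial_sum_cvg].
  rewrite expr2; under eq_fun do rewrite expr2.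
  by apply: cvgM; exact: partial_sum_cvg.
exact: cvg_unique yx yl.
Unshelve. all: by end_near. Qed.

Lemma coord_basis i j : e' j (e i) = (i == j)%:R.
Proof. by have [_ _ ee'] := basis; exact: ee'. Qed.

Lemma partial_sum_coord j n : S (e' j) n = (j < n)%:R.
Proof.
elim: n => [|n IHn]; first by rewrite partial_sum0.
rewrite partial_sumS IHn coord_basis ltnS [in RHS]leq_eqVlt eq_sym.
by case: ltngtP; rewrite /= ?addr0 ?add0r.
Qed.

(** The sequence [S (e' j)] is the indicator of [n > j]. *)
Lemma ebar_coord j : ebar (e' j) = 1.
Proof.
suff h : S (e' j) n @[n --> \oo] --> (1 : R).
  exact: cvg_unique (@partial_sum_cvg (e' j)) h.
apply: cvg_near_cst; exists j.+1 => // n /= jn.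
by rewrite partial_sum_coord jn.
Qed.

Lemma gra_A_linear : linear_relation A.
Proof.
have SD t y z n : S (t *: y + z) n = t * S y n + S z n.
  by rewrite /S mulr_sumr -big_split.
split.
  apply/gra_A_coord; split=> [|n]; first exact: linear0.
  by rewrite linear0 /S !big1// addr0.
move=> t [x y] [x' y'] /gra_A_coord[y0 yx] /gra_A_coord[y'0 yx'].
apply/gra_A_coord => /=; split=> [|n].
  by rewrite linearP/= y0 y'0 scaler0 addr0.
by rewrite linearP/= yx yx' !SD /GRing.scale/=; ring.
Qed.

Lemma gra_A_skew : skew_operator A.
Proof.
move=> [x y] /gra_A_coord[y0 yx]; rewrite /duality/=.
rewrite (@pairing_coord x y 0) ?y0 ?expr2 ?mulr0 ?subr0// => n.
by rewrite yx subr0.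
Qed.

(** These elements of the graph suffice to recover the coordinates of a related
point up to a constant. *)
Lemma gra_A_consecutive j : A (e j + e j.+1, e' j - e' j.+1).
Proof.
apply/gra_A_coord; split=> [|n]; first by rewrite linearB/= !ebar_coord subrr.
have SB m : S (e' j - e' j.+1) m = S (e' j) m - S (e' j.+1) m.
  by rewrite /S -sumrB.
rewrite !SB !partial_sum_coord linearD/= !coord_basis !ltnS.
case: (ltngtP j n) => [jn|nj|->].
- by case: (ltngtP j.+1 n) jn => //= _ _; ring.
- by rewrite gtn_eqF 1?(ltn_trans nj)// ltnNge (leq_trans (ltnW nj))//=; ring.
- by rewrite gtn_eqF// ltnNge leqnSn/=; ring.
Qed.

Hypothesis e_liminf : (0 < limn_einf (fun n => `|e n|%:E))%E.

Lemma coord_cvg0 x : e' n x @[n --> \oo] --> (0 : R).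
Proof.
have [c c0 ec] := limn_einf_gt0 e_liminf.
have [_ expand _] := basis.
have xe0 : (e' n x *: e n) @[n --> \oo] --> (0 : X).
  by apply: cvg_series_cvg_0; apply/cvg_ex; exists x; exact: expand.
apply/cvgrPdist_lt => d d0; have cd : 0 < c * d by rewrite mulr_gt0.
have /cvgrPdist_lt/(_ _ cd) xed := xe0.
near=> n; rewrite sub0r normrN.
have : `|e' n x *: e n| < c * d.
  by rewrite -normrN -sub0r; near: n.
rewrite normrZ mulrC => xn; rewrite -(ltr_pM2l c0); apply: le_lt_trans xn.
by rewrite ler_wpM2r//; near: n.
Unshelve. all: by end_near. Qed.

(** The hypothesis says that [(x, - y)] belongs to the adjoint relation
of [A]. Tested on consecutive basis vectors, it makes
[e' n x - S y n - S y n.+1] constant, and the constant is its limit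
[- 2 * ebar y]. *)
Lemma coord_of_adjoint x y :
  (forall a, A a -> a.2 x + y a.1 = 0) ->
  forall n, e' n x = S y n + S y n.+1 - 2 * ebar y.
Proof.
move=> Axy.
pose D n := e' n x - (S y n + S y n.+1).
have DS j : D j.+1 = D j.
  have : e' j x - e' j.+1 x + y (e j + e j.+1) = 0.
    exact: Axy _ (gra_A_consecutive j).
  rewrite linearD/=.
  by rewrite /D !partial_sumS; lra.
have DE n : D n = D 0 by elim: n => // n; rewrite DS.
have D_cvg : D n @[n --> \oo] --> (0 - (ebar y + ebar y) : R).
  apply: cvgB; first exact: coord_cvg0.
  apply: cvgD; first exact: partial_sum_cvg.
  by rewrite (cvg_shiftS (S y)); exact: partial_sum_cvg.
have D0 : D 0 = 0 - (ebar y + ebar y).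
  suff D_cst : D n @[n --> \oo] --> (D 0 : R) by exact: cvg_unique D_cst D_cvg.
  by apply: cvg_near_cst; near=> n; exact: DE.
by move=> n; have := DE n; rewrite D0 /D; lra.
Unshelve. all: by end_near. Qed.

(** With [pairing_coord], the coordinates of [x] give [y x = - (ebar y)^2],
while relatedness to [(0, 0)] gives [0 <= y x]; so [ebar y = 0]. *)
Lemma gra_A_related p :
  monotonically_related (@duality R X) A p -> A p.
Proof.
case: p => x y xy; have [A0 Alin] := gra_A_linear.
have AZ t a : A a -> A (t *: a) by move=> Aa; rewrite -[_ *: _]addr0; exact: Alin.
have xyE t a : A a -> 0 <= y x - t * (a.2 x + y a.1).
  move=> Aa; have := xy _ (AZ t _ Aa).
  have : duality a.1 a.2 = 0 := gra_A_skew Aa.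
  rewrite dualityBB !dualityZl !dualityZr => ->.
  by rewrite /duality; lra.
have adj a : A a -> a.2 x + y a.1 = 0.
  by move=> Aa; apply: (@affine_ge0_slope _ (y x)) => t; exact: xyE.
have yx0 : 0 <= y x by have := xyE 0 0 A0; rewrite mul0r subr0.
have xE := coord_of_adjoint adj.
have ey0 : ebar y = 0.
  move: yx0; rewrite (pairing_coord xE) => h; apply/eqP.
  by rewrite -sqrf_eq0 eq_le sqr_ge0 andbT; move: h; rewrite !expr2; lra.
by apply/gra_A_coord; split=> // n; rewrite xE ey0 mulr0 subr0.
Qed.

Lemma gra_A_maximal : maximally_monotone_operator A.
Proof.
apply: related_maximally_monotone => [|p]; last exact: gra_A_related.
move=> u v Au Av; have [_ Alin] := gra_A_linear.
have : A (u - v) by rewrite addrC -scaleN1r; exact: Alin.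
by move=> /gra_A_skew; rewrite /duality/= => ->.
Qed.

(** The differences between [(- e 0, e' 0)] and the elements of [A] all have
pairing [-1]. The numbers [alpha] and
[beta] have product [2], and [beta] is so small that no functional within [beta]
of [e' 0] is annihilated by [ebar]. *)
Lemma gra_A_not_BR : ~ type_BR A.
Proof.
move=> BR.
pose beta := (`|ebar| + 1)^-1.
have eb0 : 0 <= `|ebar| by [].
have beta0 : 0 < beta by rewrite invr_gt0 ltr_wpDl.
have alpha0 : 0 < 2 / beta by rewrite divr_gt0.
have [|b [/gra_A_coord[eb2 _] _ b2]] := BR (- e 0%N) (e' 0%N) _ _ alpha0 beta0.
  apply: (@lt_le_trans _ _ (-1)%:E).
    by rewrite divfK ?gt_eqF// lte_fin; lra.
  apply/ereal_infP => _ [[x y] Axy <-]; rewrite lee_fin.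
  have yx := gra_A_skew Axy; move: Axy => /gra_A_coord[_ /(_ 0%N)].
  rewrite partial_sumS partial_sum0 => xE.
  rewrite dualityBB !dualityNl yx /duality xE coord_basis /=; lra.
have : `|ebar (e' 0%N - b.2)| <= `|ebar| * beta.
  apply: le_trans (ler_dual_norm _ _) _; apply: ler_wpM2l => //; exact: ltW.
rewrite linearB/= eb2 ebar_coord subr0 normr1 /beta ler_pdivlMr ?ltr_wpDl//.
by rewrite mul1r; lra.
Qed.

Lemma gra_A_pairing_bidual a : A a ->
  duality (a.2 - e' 0%N)
    (canonical_embedding a.1 - (ebar - canonical_embedding (e 0%N))) = 0.
Proof.
case: a => x y Axy.
have yx : y x = 0 := gra_A_skew Axy.
have [ey0 /(_ 0%N)] := (gra_A_coord x y).1 Axy.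
rewrite partial_sumS partial_sum0 => xE.
rewrite dualityBB /=.
change (y x - e' 0%N x - (ebar y - y (e 0%N) -
  (ebar (e' 0%N) - e' 0%N (e 0%N))) = 0 :> R).
by rewrite yx ey0 ebar_coord coord_basis xE /=; lra.
Qed.

Lemma gra_A_pairing_ebar a t : A a ->
  duality (a.2 - 0) (canonical_embedding a.1 - t *: ebar) = 0.
Proof.
case: a => x y Axy.
have yx : y x = 0 := gra_A_skew Axy.
have [ey0 _] := (gra_A_coord x y).1 Axy.
rewrite subr0; change (y x - t * ebar y = 0 :> R).
by rewrite yx ey0 mulr0 subr0.
Qed.

(** The point [(ebar - e 0, e' 0)] is related to [A], but [ebar] is norm
continuous, vanishes on the range of [A] and equals [1] at [e' 0]. *)
Lemma gra_A_not_D : ~ type_D A.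
Proof.
move=> AD.
have [|I [le [a [Idir Aa _ _ a2]]]] :=
    AD (ebar - canonical_embedding (e 0%N)) (e' 0%N).
  by apply/ereal_infP => _ [a Aa <-]; rewrite gra_A_pairing_bidual.
have ? := tails_filter Idir.
have : ebar (a i).2 @[i --> tails le] --> ebar (e' 0%N).
  exact: continuous_cvg (@dual_continuous _ _ ebar _) a2.
rewrite ebar_coord.
have -> : (fun i => ebar (a i).2) = cst 0.
  apply/funext => i; have := Aa i; rewrite [a i]surjective_pairing.
  by move=> /gra_A_coord[].
move=> /(cvg_unique (@norm_hausdorff _ _) (cvg_cst _)) /eqP.
by rewrite eq_sym oner_eq0.
Qed.

(** The points [(ebar - e 0, e' 0)] and [(2 ebar, 0)] are both related to [A],
yet their mutual pairing is [-2]. *)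
Lemma gra_A_not_unique : ~ unique_operator A.
Proof.
move=> Auniq.
pose p := (ebar - canonical_embedding (e 0%N), e' 0%N).
have : 0 <= duality (p.2 - 0) (p.1 - 2 *: ebar).
  apply: (@unique_operator_related _ _ A p (2 *: ebar, 0)) => // [|a Aa|a Aa].
  - exact: gra_A_maximal.1.
  - by rewrite gra_A_pairing_bidual.
  - by rewrite gra_A_pairing_ebar.
rewrite subr0 /p; change (~ (0 <= ebar (e' 0%N) - e' 0%N (e 0%N)
  - 2 * ebar (e' 0%N) :> R)).
by rewrite ebar_coord coord_basis/=; lra.
Qed.

End Basis.

Theorem mainTheorem3 (R : realType) (X : completeNormedModType R)
    (e : nat -> X) (e' : nat -> dual X) (ebar : bidual X)
    (basis : schauder_basis e e')
    (e_cvg : canonical_embedding (\sum_(0 <= i < n) e i) @[n --> \oo] -->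
               (ebar : weak_star (dual X)))
    (e_liminf : (0 < limn_einf (fun n => `|e n|%:E))%E) :
  let A : set (X * dual X) := gra_A e ebar in
  [/\ [/\ maximally_monotone_operator A, linear_relation A & skew_operator A],
      ~ type_BR A,
      ~ type_D A,
      ~ unique_operator A &
      forall Y : completeNormedModType R, contains_copy Y X ->
        ~ space_of_type_D Y].
Proof.
move=> A; split; first split.
- exact: gra_A_maximal basis e_cvg e_liminf.
- exact: gra_A_linear basis e_cvg.
- exact: gra_A_skew basis e_cvg.
- exact: gra_A_not_BR basis e_cvg.
- exact: gra_A_not_D basis e_cvg.
- exact: gra_A_not_unique basis e_cvg e_liminf.
- move=> Y YX YD; apply: (gra_A_not_D basis e_cvg).
  apply: (space_of_type_D_copy YX YD).
  exact: gra_A_maximal basis e_cvg e_liminf.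
Qed.
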